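(* Let $x_1,x_2,y_1,y_2,u_1,u_2,v_1,v_2,\lambda$ and $\mathbf w=(w_\ell)_{\ell\ge 0}$ be indeterminates, and for $n\ge 0$ define $$\widehat Q_n(x_1,x_2,y_1,y_2,u_1,u_2,v_1,v_2,\mathbf w,\lambda)=\sum_{\sigma\in\mathfrak S_n} x_1^{\mathrm{eareccpeak}(\sigma)}x_2^{\mathrm{eareccdfall}(\sigma)}y_1^{\mathrm{ereccval}(\sigma)}y_2^{\mathrm{ereccdrise}(\sigma)}\,u_1^{\mathrm{nrcpeak}(\sigma)}u_2^{\mathrm{nrcdfall}(\sigma)}v_1^{\mathrm{nrcval}(\sigma)}v_2^{\mathrm{nrcdrise}(\sigma)}\,\mathbf w^{\mathbf{fix}(\sigma)}\lambda^{\mathrm{cyc}(\sigma)}.$$ Then the ordinary generating function of the polynomials $\widehat Q_n$ specialized to $v_1=y_1$ and $v_2=y_2$ has the J-type continued fraction $$\sum_{n=0}^\infty \widehat Q_n(x_1,x_2,y_1,y_2,u_1,u_2,y_1,y_2,\mathbf w,\lambda)\,t^n=\cfrac{1}{1-\gamma_0 t-\cfrac{\beta_1t^2}{1-\gamma_1t-\cfrac{\beta_2t^2}{1-\gamma_2 t-\cdots}}}$$ with coefficients $$\gamma_0=\lambda w_0,\qquad \gamma_n=[x_2+(n-1)u_2]+ny_2+\lambda w_n\quad(n\ge1),$$ $$\beta_n=(\lambda+n-1)\,[x_1+(n-1)u_1]\,y_1\quad(n\ge1).$$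
   Context: $\mathfrak S_n$ is the set of permutations of $[n]=\{1,\dots,n\}$. Continued fractions are identities of formal power series in $t$. For $\sigma\in\mathfrak S_n$, an index $i\in[n]$ is a record if $\sigma(j)<\sigma(i)$ for all $j<i$; an antirecord if $\sigma(j)>\sigma(i)$ for all $j>i$; an exclusive record if it is a record and not an antirecord; an exclusive antirecord if it is an antirecord and not a record; a neither-record-antirecord if it is neither a record nor an antirecord. An index $i$ is a cycle peak if $\sigma^{-1}(i)<i>\sigma(i)$; a cycle valley if $\sigma^{-1}(i)>i<\sigma(i)$; a cycle double rise if $\sigma^{-1}(i)<i<\sigma(i)$; a cycle double fall if $\sigma^{-1}(i)>i>\sigma(i)$; a fixed point if $\sigma(i)=i$. Statistics: $\mathrm{eareccpeak}(\sigma)$ [resp. $\mathrm{eareccdfall}(\sigma)$] is the number of exclusive antirecords that are also cycle peaks [resp. cycle double falls]; $\mathrm{ereccval}(\sigma)$ [resp. $\mathrm{ereccdrise}(\sigma)$] is the number of exclusive records that are also cycle valleys [resp. cycle double rises]; $\mathrm{nrcpeak},\mathrm{nrcval},\mathrm{nrcdrise},\mathrm{nrcdfall}$ are the numbers of neither-record-antirecords that are also cycle peaks, cycle valleys, cycle double rises, cycle double falls, respectively; $\mathrm{cyc}(\sigma)$ is the number of cycles (including fixed points). If $i$ is a fixed point of $\sigma$, its level is $\mathrm{lev}(i,\sigma)=\#\{j<i:\sigma(j)>i\}=\#\{j>i:\sigma(j)<i\}$. We write $\mathbf w^{\mathbf{fix}(\sigma)}=\prod_{i:\,\sigma(i)=i}w_{\mathrm{lev}(i,\sigma)}$.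 *)

(* Defs.v *)
From HB Require Import structures.
From mathcomp Require Import all_boot all_order all_algebra all_fingroup.

Set Implicit Arguments.
Unset Strict Implicit.
Unset Printing Implicit Defensive.

Import GRing.Theory.
Local Open Scope ring_scope.

(* A permutation of [n] is an element of 'S_n acting on {0, ..., n-1}: every
   statistic below depends only on the relative order of indices and values,
   so the shift by one is harmless. *)

Definition is_rec (n : nat) (s : 'S_n) (i : 'I_n) : bool :=
  [forall j : 'I_n, (j < i)%N ==> (s j < s i)%N].
Definition is_arec (n : nat) (s : 'S_n) (i : 'I_n) : bool :=
  [forall j : 'I_n, (i < j)%N ==> (s i < s j)%N].
Definition is_erec (n : nat) (s : 'S_n) (i : 'I_n) : bool :=
  is_rec s i && ~~ is_arec s i.
Definition is_earec (n : nat) (s : 'S_n) (i : 'I_n) : bool :=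
  is_arec s i && ~~ is_rec s i.
Definition is_nrar (n : nat) (s : 'S_n) (i : 'I_n) : bool :=
  ~~ is_rec s i && ~~ is_arec s i.

Definition is_cpeak (n : nat) (s : 'S_n) (i : 'I_n) : bool :=
  ((s^-1)%g i < i)%N && (s i < i)%N.
Definition is_cval (n : nat) (s : 'S_n) (i : 'I_n) : bool :=
  (i < (s^-1)%g i)%N && (i < s i)%N.
Definition is_cdrise (n : nat) (s : 'S_n) (i : 'I_n) : bool :=
  ((s^-1)%g i < i)%N && (i < s i)%N.
Definition is_cdfall (n : nat) (s : 'S_n) (i : 'I_n) : bool :=
  (i < (s^-1)%g i)%N && (s i < i)%N.

Definition eareccpeak (n : nat) (s : 'S_n) : nat :=
  #|[set i | is_earec s i && is_cpeak s i]|.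
Definition eareccdfall (n : nat) (s : 'S_n) : nat :=
  #|[set i | is_earec s i && is_cdfall s i]|.
Definition ereccval (n : nat) (s : 'S_n) : nat :=
  #|[set i | is_erec s i && is_cval s i]|.
Definition ereccdrise (n : nat) (s : 'S_n) : nat :=
  #|[set i | is_erec s i && is_cdrise s i]|.
Definition nrcpeak (n : nat) (s : 'S_n) : nat :=
  #|[set i | is_nrar s i && is_cpeak s i]|.
Definition nrcdfall (n : nat) (s : 'S_n) : nat :=
  #|[set i | is_nrar s i && is_cdfall s i]|.
Definition nrcval (n : nat) (s : 'S_n) : nat :=
  #|[set i | is_nrar s i && is_cval s i]|.
Definition nrcdrise (n : nat) (s : 'S_n) : nat :=
  #|[set i | is_nrar s i && is_cdrise s i]|.

(* [porbits s] contains the singleton orbits of the fixed points. *)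
Definition cyc (n : nat) (s : 'S_n) : nat := #|porbits s|.

Definition lev (n : nat) (i : 'I_n) (s : 'S_n) : nat :=
  #|[set j : 'I_n | (j < i)%N && (i < s j)%N]|.

Definition wfix (R : comNzRingType) (w : nat -> R) (n : nat) (s : 'S_n) : R :=
  \prod_(i < n | s i == i) w (lev i s).

(* The value of the polynomial at arbitrary elements of a commutative ring; it
   is the polynomial itself when these are the generators of a polynomial
   ring. *)
Definition Qhat (R : comNzRingType) (x1 x2 y1 y2 u1 u2 v1 v2 : R)
    (w : nat -> R) (lam : R) (n : nat) : R :=
  \sum_(s : 'S_n)
    x1 ^+ eareccpeak s * x2 ^+ eareccdfall s *
    y1 ^+ ereccval s * y2 ^+ ereccdrise s *
    u1 ^+ nrcpeak s * u2 ^+ nrcdfall s *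
    v1 ^+ nrcval s * v2 ^+ nrcdrise s *
    wfix w s * lam ^+ cyc s.

(* A series is identified with its sequence of coefficients, so the sequence
   [a : fps R] is also the ordinary generating function of the [a n]. *)

Definition fps (R : comNzRingType) : Type := nat -> R.

Definition fps0 (R : comNzRingType) : fps R := fun _ => 0.
Definition fps1 (R : comNzRingType) : fps R := fun n => (n == 0)%N%:R.
Definition fpsX (R : comNzRingType) (k : nat) : fps R := fun n => (n == k)%N%:R.
Definition fps_add (R : comNzRingType) (f g : fps R) : fps R :=
  fun n => f n + g n.
Definition fps_sub (R : comNzRingType) (f g : fps R) : fps R :=
  fun n => f n - g n.
Definition fps_scale (R : comNzRingType) (a : R) (f : fps R) : fps R :=
  fun n => a * f n.
Definition fps_mul (R : comNzRingType) (f g : fps R) : fps R :=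
  fun n => \sum_(i < n.+1) f i * g (n - i)%N.
Definition fps_exp (R : comNzRingType) (f : fps R) (k : nat) : fps R :=
  iter k (fps_mul f) (fps1 R).

(* 1 / (1 - h) = \sum_k h ^ k for a series h without constant term: since h ^ k
   has order at least k, the powers k > n do not contribute to the coefficient
   of t ^ n. See [fps_inv1BP]. *)
Definition fps_inv1B (R : comNzRingType) (h : fps R) : fps R :=
  fun n => \sum_(k < n.+1) fps_exp h k n.

(* [jconv gamma beta N k] is the N-level truncation of the tail
     1 / (1 - gamma_k t - beta_(k+1) t^2 / (1 - gamma_(k+1) t - ...)). *)
Fixpoint jconv (R : comNzRingType) (gamma beta : nat -> R) (N k : nat)
    {struct N} : fps R :=
  if N is N'.+1 then
    fps_inv1B
      (fps_add (fps_scale (gamma k) (fpsX R 1))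
               (fps_scale (beta k.+1)
                          (fps_mul (fpsX R 2) (jconv gamma beta N' k.+1))))
  else fps0 R.

(* f is the J-fraction with coefficients (gamma_n)_(n >= 0), (beta_n)_(n >= 1):
   the convergents tend to f coefficientwise, i.e. in the t-adic topology. The
   value [beta 0] is never used. *)
Definition has_jfraction (R : comNzRingType) (gamma beta : nat -> R)
    (f : fps R) : Prop :=
  forall m : nat, exists N0 : nat,
    forall N : nat, (N0 <= N)%N -> jconv gamma beta N 0 m = f m.

Lemma fps_exp_small (R : comNzRingType) (h : fps R) (k n : nat) :
  h 0%N = 0 -> (n < k)%N -> fps_exp h k n = 0.
Proof.
move=> h0; elim: k n => [//|k IHk] n ltnk.
rewrite /fps_exp iterS -/(fps_exp h k) /fps_mul big1 // => -[[|i] lti] _ /=.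
  by rewrite h0 mul0r.
by rewrite IHk ?mulr0 // ltn_subLR // addSn ltnS (leq_trans (ltnSE ltnk)) // leq_addl.
Qed.

Lemma fps_inv1BP (R : comNzRingType) (h : fps R) :
  h 0%N = 0 -> fps_mul (fps_sub (fps1 R) h) (fps_inv1B h) =1 fps1 R.
Proof.
move=> h0 n.
have invE m : (m <= n)%N -> fps_inv1B h m = \sum_(k < n.+1) fps_exp h k m.
  move=> lemn; rewrite /fps_inv1B -!(big_mkord xpredT (fun k => fps_exp h k m)).
  rewrite (@big_cat_nat _ _ _ m.+1 0 n.+1) //= (big_nat_cond _ _ m.+1) [X in _ + X]big1 ?addr0 //.
  by move=> k /andP[/andP[ltmk _] _]; rewrite fps_exp_small.
have one_mul (g : fps R) : fps_mul (fps1 R) g n = g n.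
  rewrite /fps_mul big_ord_recl /= /fps1 eqxx mul1r subn0 big1 ?addr0 // => i _.
  by rewrite mul0r.
transitivity (\sum_(k < n.+1) (fps_exp h k n - fps_exp h k.+1 n)).
  rewrite /fps_mul.
  under eq_bigr => i _ do rewrite invE ?leq_subr // big_distrr /=.
  rewrite exchange_big /=; apply: eq_bigr => k _.
  rewrite -[X in X - _](one_mul (fps_exp h k)).
  rewrite [RHS](_ : _ = fps_mul (fps1 R) (fps_exp h k) n - fps_mul h (fps_exp h k) n) //.
  rewrite /fps_mul -sumrB; apply: eq_bigr => i _.
  by rewrite /fps_sub mulrBl.
rewrite -(big_mkord xpredT (fun k => fps_exp h k n - fps_exp h k.+1 n)).
under eq_bigr => k _ do rewrite -opprB.
rewrite sumrN telescope_sumr // opprB.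
by rewrite (fps_exp_small h0 (ltnSn n)) subr0.
Qed.

(* Main.v *)
Require Import Defs.
From mathcomp Require Import all_boot all_order all_algebra all_fingroup.
From mathcomp Require Import zify ring.

Set Implicit Arguments.
Unset Strict Implicit.
Unset Printing Implicit Defensive.

Import GRing.Theory.
Local Open Scope ring_scope.

(** Scan a permutation s of N points from left to right and ignore what s does
    strictly below the current index m, apart from closed cycles.  What is left
    below m is a set of chains; a chain ends at an index whose image is still
    to be chosen and starts at a value whose preimage is still to be chosen.
    The weight of the index k in the monomial of s depends on this picture only:

    - a cycle valley starts a new chain (weight y1), and a fixed point starts
      and closes a cycle (weight lam w_h, for h chains);
    - a cycle double rise prolongs one of the h chains at its end (weight y2
      for each choice);
    - a cycle double fall prolongs one of the h chains at its start.  Its image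
      is one of the h open values, and k is an antirecord exactly when it is
      the smallest one: x2 + (h-1) u2;
    - a cycle peak picks an open value in the same way, x1 + (h-1) u1, and a
      chain end: one choice closes a cycle, h-1 choices merge two chains,
      hence the factor lam + h - 1.

    So the total weight of the ways to complete the picture depends on the
    number h of chains alone, and satisfies the recursion of weighted Motzkin
    paths from height h to height 0 ([open_sum_step], [open_sum_motzkin]).  The
    rest is the theorem of Flajolet that expands weighted Motzkin paths into a
    J-fraction ([has_jfraction_motzkin]), from the decomposition of a path at
    its first return to height 0.

    Relabelling is avoided by keeping all permutations in the same 'S_N.  Only
    the starts of the chains carry a relevant order, because the weights of
    excedances do not record whether they are records.  One may therefore shrink
    each chain to one point, placed at its start: the partial data become a
    set A of open points below m, and the other points below m are made fixed
    points, to be discounted in the number of cycles ([live_cyc]).  Swapping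
    the images of two points by a left product with a transposition removes a
    point from its chain; it changes the number of cycles by exactly one and
    leaves all later weights alone ([idx_weight_tperm]). *)

(** * Weighted Motzkin paths *)

Section WeightedMotzkinPaths.

Variables (R : comNzRingType) (up lvl down : nat -> R).

(** Paths of n steps from height k + h to height k that stay at height at least
    k, where a step is weighted by its kind and its initial height.  The floor k
    is what the tails of a J-fraction need. *)
Fixpoint motzkin (k n h : nat) : R :=
  if n is n'.+1 then
    up (k + h)%N * motzkin k n' h.+1 + lvl (k + h)%N * motzkin k n' h +
    (if h is h'.+1 then down (k + h)%N * motzkin k n' h' else 0)
  else (h == 0%N)%:R.

(** A path that ends below its start is cut at its first step from height k + 1
    to height k; until then it stays above k, so that its floor is k + 1. *)
Lemma motzkin_first_passage (k n h : nat) :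
  motzkin k n.+1 h.+1 =
  \sum_(i < n.+1) motzkin k.+1 i h * down k.+1 * motzkin k (n - i) 0.
Proof.
elim: n h => [|n IHn] h.
  rewrite big_ord1 /= !mulr0 !add0r.
  by case: h => [|h] /=; rewrite ?addn1 ?mul1r ?mulr0 ?mul0r.
have stepE m j : motzkin k m.+1 j.+1 =
    up (k.+1 + j)%N * motzkin k m j.+2 + lvl (k.+1 + j)%N * motzkin k m j.+1 +
    down (k.+1 + j)%N * motzkin k m j by rewrite [LHS]/= addnS.
rewrite stepE !IHn [RHS]big_ord_recl subn0.
under [in RHS]eq_bigr => i _ do
  rewrite [nat_of_ord (lift _ _)]add1n subSS [motzkin k.+1 _ _]/= !mulrDl.
rewrite !big_split !mulr_sumr [RHS]addrC -!addrA.
congr (_ + (_ + _)); try by apply: eq_bigr => i _; rewrite !mulrA.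
case: h => [|h].
  rewrite big1 ?add0r; last by move=> i _; rewrite !mul0r.
  by rewrite /= mul1r addn0.
rewrite IHn mulr_sumr /= !mul0r addr0.
by apply: eq_bigr => i _; rewrite !mulrA.
Qed.

(** A path that returns to its initial height k starts with a level step, or with
    a step up, after which the first step back to k cuts it in two. *)
Lemma motzkin_first_return (k n : nat) :
  motzkin k n.+2 0 =
  lvl k * motzkin k n.+1 0 +
  up k * down k.+1 * \sum_(i < n.+1) motzkin k.+1 i 0 * motzkin k (n - i) 0.
Proof.
rewrite [LHS]/= -/(motzkin k n.+1 1) -/(motzkin k n.+1 0).
rewrite motzkin_first_passage addr0 addn0 addrC; congr (_ + _).
by rewrite -mulrA; congr (_ * _); rewrite mulr_sumr; apply: eq_bigr => i _; ring.
Qed.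

End WeightedMotzkinPaths.

(** * From Motzkin paths to J-fractions *)

Section JFractionOfMotzkin.

Variables (R : comNzRingType) (gamma beta : nat -> R).

Lemma fpsX_mul (d : nat) (f : fps R) (n : nat) :
  fps_mul (fpsX R d) f n = if (d <= n)%N then f (n - d)%N else 0.
Proof.
rewrite /fps_mul /fpsX; case: leqP => [ledn | ltnd].
  rewrite (bigD1 (Ordinal (n := n.+1) (m := d) ledn)) //= eqxx mul1r.
  rewrite big1 ?addr0 // => i; rewrite -val_eqE /= => /negPf->.
  by rewrite mul0r.
rewrite big1 // => i _; rewrite ltn_eqF ?mul0r //.
by rewrite (leq_trans (ltn_ord i)).
Qed.

Lemma fps_inv1B_rec (h : fps R) (n : nat) :
  h 0%N = 0 ->
  fps_inv1B h n =
  (n == 0%N)%:R + \sum_(i < n) h i.+1 * fps_inv1B h (n - i.+1)%N.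
Proof.
move=> h0; have := fps_inv1BP h0 n.
rewrite /fps_mul /fps_sub big_ord_recl /= h0 subr0 subn0 /fps1 mul1r => <-.
rewrite -addrA -big_split /= big1 ?addr0 // => i _.
by rewrite /bump /= mulrBl mul0r sub0r addNr.
Qed.

(** The coefficient form of J = 1 + gamma_k t J + beta_(k+1) t^2 J' J, where J' is
    the tail at level k + 1: the recursion of [motzkin_first_return]. *)
Lemma jconv_rec (N k n : nat) :
  jconv gamma beta N.+1 k n =
  match n with
  | 0 => 1
  | 1 => gamma k * jconv gamma beta N.+1 k 0
  | m.+2 => gamma k * jconv gamma beta N.+1 k m.+1 +
      beta k.+1 * \sum_(i < m.+1)
        jconv gamma beta N k.+1 i * jconv gamma beta N.+1 k (m - i)%N
  end.
Proof.
set J := jconv gamma beta N.+1 k.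
rewrite /J [jconv _ _ _ _]/= fps_inv1B_rec; last first.
  by rewrite /fps_add /fps_scale fpsX_mul /fpsX !mulr0 addr0.
rewrite -/(jconv gamma beta N.+1 k) -/J.
case: n => [|n]; first by rewrite big_ord0 addr0.
rewrite add0r big_ord_recl subSS subn0.
rewrite {1}/fps_add {1 2}/fps_scale fpsX_mul /fpsX /= mulr1 mulr0 addr0.
case: n => [|n]; first by rewrite big_ord0 addr0.
congr (_ + _); rewrite mulr_sumr; apply: eq_bigr => i _.
rewrite /fps_add /fps_scale fpsX_mul /fpsX /= mulr0 add0r.
by rewrite /bump /= add1n !subSS subn0 mulrA.
Qed.

(** A path with n steps does not see the truncation at height k + N when n < N. *)
Lemma jconv_motzkin (up down : nat -> R) (N k n : nat) :
  (forall j, beta j.+1 = up j * down j.+1) -> (n < N)%N ->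
  jconv gamma beta N k n = motzkin up gamma down k n 0.
Proof.
move=> betaE; elim: N k n => [|N IHN] k n //.
elim/ltn_ind: n => -[|[|n]] IHn ltnN; rewrite jconv_rec //.
  by rewrite IHn // /= addn0 mulr0 add0r addr0.
rewrite motzkin_first_return betaE IHn //; last by lia.
congr (_ + _ * _); apply: eq_bigr => i _.
have lein : (i <= n)%N by rewrite -ltnS ltn_ord.
by rewrite IHN ?IHn //; lia.
Qed.

Lemma has_jfraction_motzkin (up down : nat -> R) (f : fps R) :
  (forall j, beta j.+1 = up j * down j.+1) ->
  (forall n, f n = motzkin up gamma down 0 n 0) ->
  has_jfraction gamma beta f.
Proof.
move=> betaE fE m; exists m.+1 => N ltmN.
by rewrite fE (jconv_motzkin _ betaE).
Qed.

End JFractionOfMotzkin.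

(** * Records and cycles of permutations *)

Section Permutations.
Variable N : nat.
Implicit Types (s t : 'S_N) (i j k a x : 'I_N) (A : {set 'I_N}).

Lemma permV_eq s i j : ((s^-1)%g i == j) = (s j == i).
Proof. by rewrite -(inj_eq (@perm_inj _ s)) permKV eq_sym. Qed.

Lemma ord_lt_card (m : nat) : (m <= N)%N -> #|[set x : 'I_N | (x < m)%N]| = m.
Proof.
move=> lemN.
by rewrite -sum1dep_card -(big_ord_widen N (fun=> 1%N)) // sum1_card card_ord.
Qed.

(** The i smaller images s j, j < i, fit below s i. *)
Lemma is_rec_geq s i : is_rec s i -> (i <= s i)%N.
Proof.
move=> /forallP rec_i; rewrite leqNgt; apply/negP => lts.
have/subset_leq_card : s @: [set x : 'I_N | (x < i)%N] \subset [set x : 'I_N | (x < s i)%N].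
  apply/subsetP => _ /imsetP[x + ->]; rewrite !inE => ltx.
  by have /implyP := rec_i x; apply.
rewrite (card_imset _ (@perm_inj _ s)) !ord_lt_card ?(ltnW (ltn_ord _)) //.
by rewrite leqNgt lts.
Qed.

Lemma is_arec_leq s i : is_arec s i -> (s i <= i)%N.
Proof.
move=> /forallP arec_i; rewrite leqNgt; apply/negP => lts.
have gtE j : ~: [set x : 'I_N | (x < j.+1)%N] = [set x : 'I_N | (j < x)%N].
  by apply/setP => x; rewrite !inE -leqNgt.
have gt_card j : #|[set x : 'I_N | (j < x)%N]| = (N - j.+1)%N.
  have := cardsC [set x : 'I_N | (x < j.+1)%N].
  by rewrite gtE ord_lt_card // card_ord => eqN; rewrite -[LHS](addKn j.+1) eqN.
have/subset_leq_card : s @: [set x : 'I_N | (i < x)%N] \subset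
    [set x : 'I_N | (s i < x)%N].
  apply/subsetP => _ /imsetP[x + ->]; rewrite !inE => ltx.
  by have /implyP := arec_i x; apply.
rewrite (card_imset _ (@perm_inj _ s)) !gt_card.
by move: (ltn_ord (s i)) lts; lia.
Qed.

(** Inserting the fixed point x into the cycle of y merges two cycles. *)
Lemma cyc_tperm_fix s x y : s x = x -> y != x -> (cyc (tperm x y * s)%g).+1 = cyc s.
Proof.
move=> sx neq_yx; have := porbits_mul_tperm s y x.
have -> : (y \in porbit s x) = false.
  apply/negbTE/porbitP => -[n yE]; case/eqP: neq_yx; rewrite yE.
  by elim: n {yE} => [|n IHn]; rewrite ?expg0 ?perm1 // expgS permM sx.
by rewrite tpermC neq_yx => /= eq_cyc; apply: (@addIn 1); rewrite -[RHS]eq_cyc -addn1 -addnA.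
Qed.

Lemma card_fixed_leq_cyc s A : (forall x, x \in A -> s x = x) -> (#|A| <= cyc s)%N.
Proof.
move=> fixA.
have fix_orbit x y : x \in A -> y \in porbit s x -> y = x.
  move=> /fixA sx /porbitP[n ->].
  by elim: n => [|n IHn]; rewrite ?expg0 ?perm1 // expgS permM sx.
rewrite /cyc -(@card_in_imset _ _ (porbit s) A).
  by apply/subset_leq_card/subsetP => _ /imsetP[x _ ->]; apply: imset_f.
by move=> x y Ax _ eq_orb; apply/esym/(fix_orbit x); rewrite // eq_orb porbit_id.
Qed.

End Permutations.

(** * The weight of one index *)

Section Weights.
Variables (R : comNzRingType) (x1 x2 y1 y2 u1 u2 lam : R) (w : nat -> R).
Variable N : nat.
Implicit Types (s t : 'S_N) (i j k a x : 'I_N) (A : {set 'I_N}).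

(** Exclusiveness does not appear because an antirecord below the diagonal
    cannot be a record; records do not appear because an excedance has the same
    weight whether or not it is one when v1 = y1 and v2 = y2. *)
Definition idx_weight s i : R :=
  if s i == i then w (lev i s)
  else if (i < s i)%N then (if ((s^-1)%g i < i)%N then y2 else y1)
  else if ((s^-1)%g i < i)%N then (if is_arec s i then x1 else u1)
  else (if is_arec s i then x2 else u2).

Lemma Qhat_idx_weight :
  Qhat x1 x2 y1 y2 u1 u2 y1 y2 w lam N =
  \sum_(s : 'S_N) (\prod_(i < N) idx_weight s i) * lam ^+ cyc s.
Proof.
apply: eq_bigr => s _; congr (_ * _).
rewrite /eareccpeak /eareccdfall /ereccval /ereccdrise.
rewrite /nrcpeak /nrcdfall /nrcval /nrcdrise -!prodr_const /wfix.
rewrite !(big_mkcond (fun i => i \in _)) (big_mkcond (fun i => s i == i)) -!big_split.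
apply: eq_bigr => i _ /=; rewrite !inE /idx_weight.
rewrite /is_earec /is_erec /is_nrar /is_cpeak /is_cval /is_cdrise /is_cdfall.
have := @is_rec_geq _ s i; have := @is_arec_leq _ s i.
have := permV_eq s i i; rewrite -!val_eqE /=.
set p := nat_of_ord ((s^-1)%g i); set q := nat_of_ord (s i).
case: (is_rec s i); case: (is_arec s i);
  case: (ltngtP q i) => //=; case: (ltngtP p i) => //= _ _ eqpq ha hr;
  try (by have := ha isT); try (by have := hr isT);
  by rewrite ?mul1r ?mulr1.
Qed.

(** * Permutations with open points *)

(** The points of A are the chains that are open before index m.  That their
    preimages are at least m too is a consequence, [open_at_geqV]. *)
Definition open_at (m : nat) A s : bool :=
  [forall x : 'I_N, (x < m)%N ==>
     if x \in A then (m <= s x)%N else s x == x].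

Lemma open_atP m A s :
  reflect (forall x, (x < m)%N -> if x \in A then (m <= s x)%N else s x == x)
          (open_at m A s).
Proof. exact: 'forall_implyP. Qed.

Definition below (m : nat) A := forall x, x \in A -> (x < m)%N.

Lemma below_card m A : (m <= N)%N -> below m A -> (#|A| <= m)%N.
Proof.
move=> lemN ltAm; have <- := @ord_lt_card N m lemN.
by apply/subset_leq_card/subsetP => x /ltAm; rewrite inE.
Qed.

Lemma open_at_image m A s j :
  open_at m A s -> (m <= j)%N -> (s j < m)%N -> s j \in A.
Proof.
move=> /open_atP os lemj ltsj; apply: contraLR lemj => nAsj.
by have := os _ ltsj; rewrite (negPf nAsj) -ltnNge => /eqP/perm_inj <-.
Qed.

Lemma open_at_preimage m A s j :
  open_at m A s -> (m <= s j)%N -> (j < m)%N -> j \in A.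
Proof.
move=> /open_atP os lemj ltj; apply: contraLR lemj => nAj.
by have := os _ ltj; rewrite (negPf nAj) -ltnNge => /eqP ->.
Qed.

(** No point below m is sent to an open point: an open point is sent to m or
    above, and the other points below m are fixed. *)
Lemma open_at_geqV m A s x :
  below m A -> open_at m A s -> x \in A -> (m <= (s^-1)%g x)%N.
Proof.
move=> ltAm /open_atP os Ax; rewrite leqNgt; apply/negP => lty.
have := os _ lty; rewrite permKV; case: ifP => [_ | nAy /eqP xE].
  by rewrite leqNgt ltAm.
by rewrite -xE Ax in nAy.
Qed.

Lemma open_at_valley k A s : below k A ->
  open_at k A s && (k < s k)%N && (k < (s^-1)%g k)%N = open_at k.+1 (k |: A) s.
Proof.
move=> ltAk; apply/andP/idP => [[/andP[/open_atP os ltk] ltVk] | os'].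
  apply/open_atP => x; rewrite ltnS !inE leq_eqVlt.
  case/orP => [/eqP/val_inj-> | ltxk]; first by rewrite eqxx.
  have -> : (x == k) = false by apply/negbTE; rewrite -val_eqE /= ltn_eqF.
  have := os x ltxk; case: (x \in A) => //=; rewrite leq_eqVlt => /orP[/eqP/val_inj kE|//].
  by move: ltVk; rewrite {2}kE permK ltnNge ltnW.
have ltAk' : below k.+1 (k |: A).
  by move=> x; rewrite !inE => /orP[/eqP->//| /ltAk/ltnW].
rewrite (open_at_geqV ltAk' os' (setU11 _ _)); split=> //.
move/open_atP: os' => os; have := os k (leqnn _); rewrite setU11 => ->.
rewrite andbT; apply/open_atP => x ltxk; have := os x (ltnW ltxk).
by rewrite !inE -val_eqE /= ltn_eqF //=; case: (x \in A) => //= /ltnW.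
Qed.

Lemma open_at_fix k A s : below k A ->
  open_at k A s && (s k == k) = open_at k.+1 A s.
Proof.
move=> ltAk; have nAk : k \in A = false by apply/negbTE/negP => /ltAk; rewrite ltnn.
apply/andP/idP => [[/open_atP os /eqP sk] | /open_atP os].
  apply/open_atP => x; rewrite ltnS leq_eqVlt.
  case/orP => [/eqP/val_inj-> | ltxk]; first by rewrite nAk sk.
  have := os x ltxk; case: (x \in A) => //=; rewrite leq_eqVlt => /orP[/eqP/val_inj kE|//].
  by move: ltxk; rewrite -(perm_inj (etrans sk kE)) ltnn.
have := os k (leqnn _); rewrite nAk => ->; split=> //.
apply/open_atP => x ltxk; have := os x (ltnW ltxk).
by case: (x \in A) => //= /ltnW.
Qed.

(** Undoing a cycle double rise of s' = tperm a k * s: if k is the image of the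
    open point a under s', then swapping the images of a and k makes k a fixed
    point of s and gives a the former image of k. *)
Lemma open_at_rise k A a s : below k A -> a \in A ->
  [&& open_at k A (tperm a k * s)%g, (k < (tperm a k * s)%g k)%N &
      (tperm a k * s)%g a == k] = open_at k.+1 A s.
Proof.
move=> ltAk Aa; rewrite -open_at_fix // !permM tpermL tpermR.
have neqka x : (x < k)%N -> k == x = false.
  by move=> ltx; apply/negbTE; rewrite -val_eqE /= gtn_eqF.
have ltak := ltAk a Aa.
apply/and3P/andP => [[/open_atP os ltk /eqP sk] | [/open_atP os /eqP sk]].
  rewrite sk eqxx; split=> //; apply/open_atP => x ltxk.
  have [-> | neq_xa] := eqVneq x a; first by rewrite Aa ltnW.
  by have := os x ltxk; rewrite permM tpermD ?neqka // eq_sym.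
rewrite sk eqxx; split=> //.
  apply/open_atP => x ltxk; rewrite permM.
  have [-> | neq_xa] := eqVneq x a; first by rewrite Aa tpermL sk.
  by have := os x ltxk; rewrite tpermD ?neqka // eq_sym.
have := os a ltak; rewrite Aa leq_eqVlt => /orP[/eqP/val_inj kE|//].
by have := neqka a ltak; rewrite (perm_inj (etrans sk kE)) eqxx.
Qed.

(** If s' = tperm a k * s sends k to the open point a, then swapping the images of
    a and k closes a, and k takes over its chain, whose start is now k.  The index
    k becomes a cycle valley of s if it was a double fall of s'.  If it was a
    peak, it becomes a fixed point when its preimage was a, that is, when it
    closed the cycle of a, and a double rise otherwise. *)
Lemma open_at_fall k A a s : below k A -> a \in A ->
  open_at k A (tperm a k * s)%g && ((tperm a k * s)%g k == a) =
  open_at k (A :\ a) s && (k <= s k)%N.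
Proof.
move=> ltAk Aa; rewrite !permM tpermR.
have neqka x : (x < k)%N -> k == x = false.
  by move=> ltx; apply/negbTE; rewrite -val_eqE /= gtn_eqF.
have ltak := ltAk a Aa.
apply/andP/andP => [[/open_atP os /eqP sa] | [/open_atP os lek]].
  have := os a ltak; rewrite Aa permM tpermL => ->; split=> //.
  apply/open_atP => x ltxk; rewrite !inE.
  have [-> | neq_xa] := eqVneq x a; first by rewrite /= sa eqxx.
  by have := os x ltxk; rewrite permM tpermD ?neqka // eq_sym.
have := os a ltak; rewrite !inE eqxx /= => ->; split=> //.
apply/open_atP => x ltxk; rewrite permM.
have [-> | neq_xa] := eqVneq x a; first by rewrite Aa tpermL.
by have := os x ltxk; rewrite !inE neq_xa tpermD ?neqka // eq_sym.
Qed.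

Lemma lev_open_at k A s : below k A -> open_at k A s -> s k = k -> lev k s = #|A|.
Proof.
move=> ltAk os sk; apply: eq_card => x; rewrite inE.
apply/andP/idP => [[ltx lts] | Ax]; first exact: open_at_preimage os (ltnW lts) ltx.
have ltx := ltAk x Ax; split=> //.
move/open_atP: os => /(_ x ltx); rewrite Ax leq_eqVlt => /orP[/eqP/val_inj kE|//].
by move: ltx; rewrite -(perm_inj (etrans sk kE)) ltnn.
Qed.

(** The values below k that are taken after k are open, so the image of k only has
    to be compared with the open points. *)
Lemma is_arec_open_at k A s : below k A -> open_at k A s -> s k \in A ->
  is_arec s k = [forall b in A, s k <= b]%N.
Proof.
move=> ltAk os Ask; apply/forallP/forall_inP => [arec_k b Ab | min_sk j].
  have := open_at_geqV ltAk os Ab; rewrite leq_eqVlt => /orP[/eqP/val_inj kE|ltk].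
    by rewrite kE permKV.
  by have /implyP/(_ ltk) := arec_k ((s^-1)%g b); rewrite permKV => /ltnW.
apply/implyP => ltkj; case: (ltnP (s j) k) => [ltsj | ]; last exact: leq_trans (ltAk _ Ask).
have := min_sk _ (open_at_image os (ltnW ltkj) ltsj).
rewrite leq_eqVlt => /orP[/eqP/val_inj/perm_inj kE|//].
by rewrite kE ltnn in ltkj.
Qed.

(** * Later weights and cycles *)

Definition tail_weight (m : nat) s : R := \prod_(j < N | (m <= j)%N) idx_weight s j.

Lemma tail_weightS k s :
  tail_weight k s = idx_weight s k * tail_weight k.+1 s.
Proof.
rewrite /tail_weight (bigD1 k) //=; congr (_ * _); apply: eq_bigl => j.
by rewrite ltn_neqAle eq_sym andbC.
Qed.

(** The weight of j sees what happens before j only through the set of images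
    of the indices below j, and through comparison of a preimage with j. *)
Lemma idx_weight_tperm a k j s : (a < j)%N -> (k < j)%N ->
  idx_weight (tperm a k * s)%g j = idx_weight s j.
Proof.
move=> ltaj ltkj.
have tfix i : (j <= i)%N -> tperm a k i = i.
  move=> leji; rewrite tpermD // -val_eqE /= ltn_eqF //; exact: leq_trans leji.
have tlt i : (tperm a k i < j)%N = (i < j)%N.
  by case: tpermP => [->|->|//]; rewrite ltaj ltkj.
have arecE : is_arec (tperm a k * s)%g j = is_arec s j.
  apply: eq_forallb => i; rewrite !permM (tfix j) //.
  by case: (ltnP j i) => //= ltji; rewrite tfix // ltnW.
have levE : lev j (tperm a k * s)%g = lev j s.
  rewrite /lev -[RHS](card_preimset _ (@perm_inj _ (tperm a k))).
  by apply: eq_card => i; rewrite !inE tlt permM.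
by rewrite /idx_weight arecE levE invMg !permM tpermV tlt tfix.
Qed.

Lemma tail_weight_tperm a k s : (a < k)%N ->
  tail_weight k.+1 (tperm a k * s)%g = tail_weight k.+1 s.
Proof.
move=> ltak; apply: eq_bigr => j ltkj; apply: idx_weight_tperm => //.
exact: ltn_trans ltkj.
Qed.

(** The subtracted number counts the points below m that have been closed; each
    of them is a fixed point of s in [open_at m A], hence a cycle to be ignored. *)
Definition live_cyc (m : nat) A s : nat := (cyc s - (m - #|A|))%N.

Lemma live_cyc_fix k A s : below k A -> open_at k.+1 A s ->
  live_cyc k A s = (live_cyc k.+1 A s).+1.
Proof.
move=> ltAk /open_atP os; have leAk := below_card (ltnW (ltn_ord k)) ltAk.
have : (k.+1 - #|A| <= cyc s)%N.
  pose D := [set x : 'I_N | (x < k.+1)%N] :\: A.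
  have <- : #|D| = (k.+1 - #|A|)%N.
    rewrite cardsDS ?ord_lt_card //.
    by apply/subsetP => x /ltAk; rewrite inE => /ltnW.
  apply: card_fixed_leq_cyc => x; rewrite !inE => /andP[nAx /os].
  by rewrite (negPf nAx) => /eqP.
by rewrite /live_cyc subSn // => /subnSK ->.
Qed.

Lemma live_cyc_rise k A a s : below k A -> a \in A -> s k = k ->
  live_cyc k A (tperm a k * s)%g = live_cyc k.+1 A s.
Proof.
move=> ltAk Aa sk; have leAk := below_card (ltnW (ltn_ord k)) ltAk.
have neq_ak : a != k by rewrite -val_eqE /= ltn_eqF // ltAk.
rewrite /live_cyc subSn // -(cyc_tperm_fix sk neq_ak) subSS.
by rewrite (tpermC k).
Qed.

Lemma live_cyc_fall k A a s : below k A -> a \in A -> s a = a ->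
  live_cyc k A (tperm a k * s)%g = live_cyc k (A :\ a) s.
Proof.
move=> ltAk Aa sa; have leAk := below_card (ltnW (ltn_ord k)) ltAk.
have neq_ka : k != a by rewrite -val_eqE /= gtn_eqF // ltAk.
rewrite /live_cyc -(cyc_tperm_fix sa neq_ka).
have cardA := cardsD1 a A; rewrite Aa add1n in cardA.
by rewrite -subSS cardA subnSK // -cardA.
Qed.

(** * The recursion over the indices *)

Definition open_sum (m : nat) A : R :=
  \sum_(s | open_at m A s) tail_weight m s * lam ^+ live_cyc m A s.

(** A term of [open_sum k A], stripped of the weight of the index k. *)
Definition next_term k A s : R := tail_weight k.+1 s * lam ^+ live_cyc k A s.

Lemma sum_valley k A : below k A ->
  \sum_(s | open_at k A s && (k < s k)%N && (k < (s^-1)%g k)%N) next_term k A s =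
  open_sum k.+1 (k |: A).
Proof.
move=> ltAk; apply: eq_big => [s | s _]; first exact: open_at_valley.
have nAk : k \notin A by apply/negP => /ltAk; rewrite ltnn.
by rewrite /next_term /live_cyc cardsU1 nAk add1n subSS.
Qed.

Lemma sum_fix k A : below k A ->
  \sum_(s | open_at k A s && (s k == k)) next_term k A s =
  lam * open_sum k.+1 A.
Proof.
move=> ltAk; rewrite mulr_sumr; apply: eq_big => [s | s]; first exact: open_at_fix.
rewrite open_at_fix // => os.
by rewrite /next_term (live_cyc_fix ltAk os) exprS mulrCA.
Qed.

Lemma sum_rise k A : below k A ->
  \sum_(s | open_at k A s && (k < s k)%N && ((s^-1)%g k < k)%N) next_term k A s =
  #|A|%:R * open_sum k.+1 A.
Proof.
move=> ltAk.
rewrite (partition_big (fun s => (s^-1)%g k) (mem A)) /=; last first.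
  move=> s /andP[/andP[os _] ltV]; apply: open_at_preimage os _ ltV.
  by rewrite permKV.
rewrite mulr_natl -sumr_const; apply: eq_bigr => a Aa.
have ltak := ltAk a Aa.
rewrite (reindex_inj (mulgI (tperm a k))); apply: eq_big => [s | s].
  rewrite -(open_at_rise s ltAk Aa) permV_eq -!andbA.
  case: eqP => [eqk|]; rewrite ?andbF //.
  have -> : ((tperm a k * s)^-1)%g k = a by apply/eqP; rewrite permV_eq eqk.
  by rewrite ltak.
rewrite permV_eq => /andP[_]; rewrite permM tpermL => /eqP sk.
by rewrite /next_term tail_weight_tperm // live_cyc_rise.
Qed.

Lemma valley_excedance k s :
  (k <= s k)%N && (k < (s^-1)%g k)%N = (k < s k)%N && (k < (s^-1)%g k)%N.
Proof.
apply: andb_id2r => ltV; rewrite leq_eqVlt; case: eqP => // /val_inj kE.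
by move: ltV; rewrite {2}kE permK ltnn.
Qed.

Lemma sum_nonvalley k A (f : 'S_N -> R) :
  \sum_(s | open_at k A s && (k <= s k)%N && ~~ (k < (s^-1)%g k)%N) f s =
  \sum_(s | open_at k A s && (s k == k)) f s +
  \sum_(s | open_at k A s && (k < s k)%N && ((s^-1)%g k < k)%N) f s.
Proof.
rewrite (bigID (fun s => s k == k)) /=; congr (_ + _); apply: eq_bigl => s;
  rewrite -!andbA; congr (_ && _); have := permV_eq s k k; rewrite -!val_eqE /=;
  by case: (ltngtP k (s k)); case: (ltngtP k ((s^-1)%g k)).
Qed.

(** The case c = true is that of double falls, c = false that of peaks.  After the
    swap of [open_at_fall] the sums are those of valleys, resp. of fixed points
    and double rises, for the open set A without a; the fixed points yield lam
    and the double rises the number of remaining chains. *)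
Lemma sum_fall k A a (c : bool) : below k A -> a \in A ->
  \sum_(s | open_at k A s && (s k == a) && ((k < (s^-1)%g k)%N == c))
     next_term k A s =
  if c then open_sum k.+1 (k |: (A :\ a))
  else (lam + #|A :\ a|%:R) * open_sum k.+1 (A :\ a).
Proof.
move=> ltAk Aa; have ltak := ltAk a Aa.
have ltDk : below k (A :\ a) by move=> x; rewrite inE => /andP[_ /ltAk].
have gtVE s : (k < ((tperm a k * s)^-1)%g k)%N = (k < (s^-1)%g k)%N.
  rewrite invMg permM tpermV; case: tpermP => [->|->|//].
    by rewrite ltnn ltnNge ltnW.
  by rewrite ltnn ltnNge ltnW.
rewrite (reindex_inj (mulgI (tperm a k))).
transitivity (\sum_(s | open_at k (A :\ a) s && (k <= s k)%N &&
    ((k < (s^-1)%g k)%N == c)) next_term k (A :\ a) s).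
  apply: eq_big => [s | s]; first by rewrite open_at_fall // gtVE.
  case/andP => /andP[_]; rewrite permM tpermR => /eqP sa _.
  by rewrite /next_term tail_weight_tperm // live_cyc_fall.
case: c.
  rewrite -sum_valley //; apply: eq_bigl => s.
  by rewrite eqb_id -!andbA valley_excedance.
rewrite mulrDl -sum_fix // -sum_rise // -sum_nonvalley.
by apply: eq_bigl => s; rewrite eqbF_neg.
Qed.

(** The choice of the image of an antiexcedance: only the least open point makes
    it an antirecord. *)
Lemma sum_min_other A (x y : R) :
  \sum_(a in A) (if [forall b in A, a <= b]%N then x else y) =
  if #|A| is h.+1 then x + h%:R * y else 0.
Proof.
have [-> | [a0 Aa0]] := set_0Vmem A; first by rewrite big_set0 cards0.
have [m Am min_m] := arg_minnP (fun i : 'I_N => i : nat) Aa0.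
rewrite (cardsD1 m) [m \in A]Am (bigD1 m) //=; congr (_ + _).
  by rewrite ifT //; apply/forall_inP.
rewrite mulr_natl -sumr_const; apply: eq_big => [a | a /andP[Aa neq_am]].
  by rewrite !inE andbC.
rewrite ifF //; apply/negbTE/forall_inPn; exists m => //.
by rewrite -ltnNge ltn_neqAle min_m // andbT eq_sym.
Qed.

Lemma open_sum_step k A : below k A ->
  open_sum k A =
  y1 * open_sum k.+1 (k |: A) +
  (#|A|%:R * y2 + lam * w #|A|) * open_sum k.+1 A +
  \sum_(a in A)
    ((if [forall b in A, a <= b]%N then x2 else u2) * open_sum k.+1 (k |: (A :\ a)) +
     (if [forall b in A, a <= b]%N then x1 else u1) *
       ((lam + #|A :\ a|%:R) * open_sum k.+1 (A :\ a))).
Proof.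
move=> ltAk; rewrite [LHS]/open_sum.
under eq_bigr => s _ do rewrite tail_weightS -mulrA -/(next_term k A s).
rewrite (bigID (fun s => k <= s k)%N) /=; congr (_ + _).
  rewrite (bigID (fun s => k < (s^-1)%g k)%N) /= -sum_valley // mulr_sumr.
  congr (_ + _).
    apply: eq_big => [s | s]; rewrite -!andbA valley_excedance //.
    case/and3P => _ lt1 lt2.
    by rewrite /idx_weight -val_eqE /= gtn_eqF // lt1 ltnNge ltnW.
  rewrite sum_nonvalley addrC mulrDl; congr (_ + _).
    rewrite mulrAC -sum_rise // mulr_suml.
    apply: eq_bigr => s /andP[/andP[_ lt1] lt2].
    by rewrite /idx_weight -val_eqE /= gtn_eqF // lt1 lt2 mulrC.
  rewrite mulrAC -sum_fix // mulr_suml.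
  apply: eq_bigr => s /andP[os /eqP sk].
  by rewrite /idx_weight sk eqxx (lev_open_at ltAk) // mulrC.
rewrite (partition_big (fun s => s k) (mem A)) /=; last first.
  by move=> s /andP[os]; rewrite -ltnNge; apply: open_at_image os _.
apply: eq_bigr => a Aa; have ltak := ltAk a Aa.
rewrite -(sum_fall true ltAk Aa) -(sum_fall false ltAk Aa) !mulr_sumr.
rewrite (bigID (fun s => k < (s^-1)%g k)%N) /=.
have predE s : open_at k A s && ~~ (k <= s k)%N && (s k == a) = open_at k A s && (s k == a).
  by case: eqP => [->|]; rewrite ?andbF // -ltnNge ltak andbT.
congr (_ + _); apply: eq_big => [s | s]; rewrite ?eqb_id ?eqbF_neg predE //.
  case/andP => /andP[os /eqP sk] ltV; rewrite /idx_weight sk.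
  rewrite -val_eqE /= ltn_eqF // ltnNge ltnW //= ltnNge ltnW //=.
  by rewrite (is_arec_open_at ltAk) ?sk.
case/andP => /andP[os /eqP sk] geV; rewrite /idx_weight sk.
rewrite -val_eqE /= ltn_eqF // ltnNge ltnW //=.
have -> : ((s^-1)%g k < k)%N.
  rewrite ltn_neqAle leqNgt geV andbT val_eqE permV_eq sk.
  by rewrite -val_eqE /= ltn_eqF.
by rewrite (is_arec_open_at ltAk) ?sk.
Qed.

(** The valley weight y1 is put on the steps up, the peak weights on the steps
    down; only the product of a step up and the matching step down counts. *)
Definition up_weight (h : nat) : R := y1.
Definition level_weight (h : nat) : R :=
  if h is m.+1 then (x2 + m%:R * u2) + h%:R * y2 + lam * w h else lam * w 0%N.
Definition down_weight (h : nat) : R := (lam + h.-1%:R) * (x1 + h.-1%:R * u1).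

Lemma open_sum_motzkin n m A : (m + n)%N = N -> below m A ->
  open_sum m A = motzkin up_weight level_weight down_weight 0 n #|A|.
Proof.
elim: n m A => [|n IHn] m A eqN ltAm.
  (* All N points are below m: an open point has no possible image, and without
     open points the identity is left, whose N cycles are all discounted. *)
  rewrite addn0 in eqN; rewrite /open_sum /=.
  have ltm (x : 'I_N) : (x < m)%N by rewrite eqN.
  have [-> | [a Aa]] := set_0Vmem A.
    rewrite (big_pred1 1%g) => [|s]; last first.
      apply/open_atP/eqP => [os | -> x _]; last by rewrite inE perm1.
      apply/permP => x; rewrite perm1; apply/eqP.
      by have := os x (ltm x); rewrite inE.
    rewrite /tail_weight big_pred0 => [|j]; last by rewrite leqNgt ltm.
    have le_cyc : (cyc (1 : 'S_N)%g <= N)%N.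
      by rewrite -[leqRHS]card_ord; apply: leq_imset_card.
    rewrite /live_cyc cards0 subn0 eqN (eqP (_ : _ - N == 0)%N) ?expr0 ?mulr1 //.
  rewrite big_pred0 => [|s]; last first.
    apply/negbTE/negP => /open_atP /(_ a (ltm a)).
    by rewrite Aa leqNgt ltm.
  by rewrite (cardsD1 a) Aa.
have ltmN : (m < N)%N by rewrite -eqN addnS ltnS leq_addr.
pose k := Ordinal ltmN; have eqN' : (m.+1 + n)%N = N by rewrite addSnnS.
have below1 B : below k B -> below m.+1 B by move=> ltB x /ltB/ltnW.
have belowU B : below k B -> below m.+1 (k |: B).
  by move=> ltB x; rewrite !inE => /orP[/eqP->//|/ltB/ltnW].
have belowD a : below k (A :\ a) by move=> x; rewrite inE => /andP[_ /ltAm].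
have nk B : below k B -> k \notin B.
  by move=> ltB; apply/negP => /ltB; rewrite ltnn.
rewrite (open_sum_step (k := k)) // (IHn m.+1 (k |: A)) // ?(IHn m.+1 A) //;
  try by [apply: belowU | apply: below1].
rewrite cardsU1 nk // add1n.
pose M := motzkin up_weight level_weight down_weight 0 n.
have sumE : \sum_(a in A)
    ((if [forall b in A, a <= b]%N then x2 else u2) * open_sum m.+1 (k |: (A :\ a)) +
     (if [forall b in A, a <= b]%N then x1 else u1) *
       ((lam + #|A :\ a|%:R) * open_sum m.+1 (A :\ a))) =
  (if #|A| is h.+1 then x2 + h%:R * u2 else 0) * M #|A| +
  (if #|A| is h.+1 then x1 + h%:R * u1 else 0) *
    ((lam + #|A|.-1%:R) * M #|A|.-1).
  rewrite -!sum_min_other !mulr_suml -big_split; apply: eq_bigr => a Aa /=.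
  have cardA := cardsD1 a A; rewrite Aa add1n in cardA.
  rewrite (IHn m.+1 (k |: _)) ?(IHn m.+1 (A :\ a)) //;
    try by [apply: belowU | apply: below1].
  by rewrite cardsU1 nk // add1n cardA.
rewrite sumE /M /= /level_weight /down_weight /up_weight add0n.
case: #|A| => [|h] /=; rewrite ?add0n; ring.
Qed.

End Weights.

Theorem theorem2p4 (R : comNzRingType) (x1 x2 y1 y2 u1 u2 lam : R) (w : nat -> R) :
  has_jfraction
    (fun n => if n is m.+1 then (x2 + m%:R * u2) + n%:R * y2 + lam * w n
              else lam * w 0%N)
    (fun n => (lam + n.-1%:R) * (x1 + n.-1%:R * u1) * y1)
    (fun n => Qhat x1 x2 y1 y2 u1 u2 y1 y2 w lam n).
Proof.
apply: (has_jfraction_motzkin (up := up_weight y1) (down := down_weight x1 u1 lam)).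
  by move=> j; rewrite /up_weight /down_weight mulrC.
move=> n; rewrite Qhat_idx_weight.
have below0 : below 0 (set0 : {set 'I_n}) by move=> x; rewrite inE.
rewrite -[RHS](_ : open_sum x1 x2 y1 y2 u1 u2 lam w 0 (set0 : {set 'I_n}) = _); last first.
  by rewrite (open_sum_motzkin _ _ _ _ _ _ _ _ (n := n)) // cards0.
rewrite /open_sum; apply: eq_big => [s | s _]; first by apply/esym/open_atP.
by rewrite /live_cyc cards0 !subn0.
Qed.
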